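(* For all $\epsilon>0$ small enough, the space $R^\natural_\pi(B^3,A_1\cup A_2)$, $\pi=(P,f,\epsilon)$, is homeomorphic to a circle, parameterized by $\beta\in\mathbb{R}/2\pi\mathbb{Z}$ by the assignment $$\rho(\beta):\ a\mapsto\mathbf i,\quad b\mapsto e^{(\frac\pi2+\beta+\epsilon f(\beta))\mathbf k}\mathbf i,\quad c\mapsto e^{(\frac\pi2+\beta-\epsilon f(\beta))\mathbf k}\mathbf i,\quad d\mapsto e^{-2\epsilon f(\beta)\mathbf k}\mathbf i,$$ $$h\mapsto-\mathbf j\,e^{-\epsilon f(\beta)\mathbf k},\quad p\mapsto e^{\epsilon f(\beta)\mathbf k},\quad w\mapsto-1.$$
   Context: $SU(2)$ is identified with the unit quaternions; $C(\mathbf i)$ is the set of pure (traceless) unit quaternions; $e^{tQ}=\cos t+\sin t\,Q$ for $Q\in C(\mathbf i)$. Bars denote inverses in groups and $[x,y]=xy\bar x\bar y$. $A_1\cup A_2\subset B^3$ is a pair of unknotted arcs in a 3-ball, $H$ is a small meridian circle of $A_1$, $W$ is a short arc joining $H$ and $A_1$, and $P\subset B^3\setminus(A_1\cup A_2\cup H\cup W)$ is an unknotted circle linking $A_2$ and $H$. With $a,b,c,d$ the meridians at the four endpoints of the arcs, $h,w,p$ meridians of $H,W,P$, and longitude $\lambda_P=bh$ of $P$, $$\pi_1(B^3\setminus(A_1\cup A_2\cup H\cup W\cup P))=\langle a,b,c,d,h,w,p\mid c=\bar pbp,\ d=\bar cba,\ [bh,p]=1,\ [a\bar p,h]=(ha)w(\bar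 a\bar h)\rangle .$$ $f:\mathbb{R}\to\mathbb{R}$ is a fixed smooth function with $f(0)=0$, $|f(x)|\le1$, $f(-x)=-f(x)$, $f$ $2\pi$-periodic, and $f(x)\ne0$ when $x$ is not a multiple of $\pi$. $R^\natural_\pi(B^3,A_1\cup A_2)$ is the space of conjugacy classes of homomorphisms $\pi_1(B^3\setminus(A_1\cup A_2\cup H\cup W\cup P))\to SU(2)$ which send $a,b,c,d,h$ into $C(\mathbf i)$, send $w$ to $-1$, and satisfy the perturbation condition: if $\lambda_P=bh$ is sent to $e^{\beta Q}$ and $p$ to $e^{\nu Q}$ for some $Q\in C(\mathbf i)$, then $\nu=\epsilon f(\beta)$ (i.e. $p\mapsto e^{\epsilon f(\beta)Q}$ whenever $\lambda_P\mapsto e^{\beta Q}$). *)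

(* Defs.v *)
From HB Require Import structures.
From mathcomp Require Import all_boot all_order all_algebra.
From mathcomp Require Import generic_quotient.
From mathcomp Require Import all_classical all_reals all_analysis.
From mathcomp Require Import ring.

Set Implicit Arguments.
Unset Strict Implicit.
Unset Printing Implicit Defensive.

Import Order.TTheory GRing.Theory Num.Theory.
Import numFieldNormedType.Exports.

Local Open Scope classical_set_scope.
Local Open Scope ring_scope.
Local Open Scope quotient_scope.

(* Quat t x y z is t + xi + yj + zk. *)
Record quat (R : realType) : Type := Quat { qre : R; qix : R; qjy : R; qkz : R }.
Arguments Quat {R}.

Section Quaternions.
Variable R : realType.

Definition quat_coord (q : quat R) : R * R * R * R := (qre q, qix q, qjy q, qkz q).
Definition quat_of_coord (v : R * R * R * R) : quat R :=
  Quat v.1.1.1 v.1.1.2 v.1.2 v.2.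

Lemma quat_coordK : cancel quat_coord quat_of_coord.
Proof. by case. Qed.

HB.instance Definition _ := Equality.copy (quat R) (can_type quat_coordK).
HB.instance Definition _ := Choice.copy (quat R) (can_type quat_coordK).
HB.instance Definition _ := Topological.copy (quat R) (initial_topology quat_coord).

Definition qadd (p q : quat R) : quat R :=
  Quat (qre p + qre q) (qix p + qix q) (qjy p + qjy q) (qkz p + qkz q).

Definition qopp (q : quat R) : quat R := Quat (- qre q) (- qix q) (- qjy q) (- qkz q).

Definition qscale (c : R) (q : quat R) : quat R :=
  Quat (c * qre q) (c * qix q) (c * qjy q) (c * qkz q).

Definition qmul (p q : quat R) : quat R :=
  let: Quat t x y z := p in
  let: Quat t' x' y' z' := q in
  Quat (t * t' - x * x' - y * y' - z * z')
       (t * x' + x * t' + y * z' - z * y')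
       (t * y' - x * z' + y * t' + z * x')
       (t * z' + x * y' - y * x' + z * t').

Lemma qaddA : associative qadd.
Proof. by move=> [? ? ? ?] [? ? ? ?] [? ? ? ?]; congr Quat; rewrite /=; ring. Qed.

Lemma qaddC : commutative qadd.
Proof. by move=> [? ? ? ?] [? ? ? ?]; congr Quat; rewrite /=; ring. Qed.

Lemma qadd0q : left_id (Quat 0 0 0 0) qadd.
Proof. by move=> [? ? ? ?]; congr Quat; rewrite /=; ring. Qed.

Lemma qaddNq : left_inverse (Quat 0 0 0 0) qopp qadd.
Proof. by move=> [? ? ? ?]; congr Quat; rewrite /=; ring. Qed.

HB.instance Definition _ := GRing.isZmodule.Build (quat R) qaddA qaddC qadd0q qaddNq.

Lemma qmulA : associative qmul.
Proof. by move=> [? ? ? ?] [? ? ? ?] [? ? ? ?]; congr Quat; rewrite /=; ring. Qed.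

Lemma qmul1q : left_id (Quat 1 0 0 0) qmul.
Proof. by move=> [? ? ? ?]; congr Quat; rewrite /=; ring. Qed.

Lemma qmulq1 : right_id (Quat 1 0 0 0) qmul.
Proof. by move=> [? ? ? ?]; congr Quat; rewrite /=; ring. Qed.

Lemma qmulDl : left_distributive qmul +%R.
Proof. by move=> [? ? ? ?] [? ? ? ?] [? ? ? ?]; congr Quat; rewrite /=; ring. Qed.

Lemma qmulDr : right_distributive qmul +%R.
Proof. by move=> [? ? ? ?] [? ? ? ?] [? ? ? ?]; congr Quat; rewrite /=; ring. Qed.

Lemma quat1_neq0 : Quat 1 0 0 0 != 0 :> quat R.
Proof. by apply/eqP => -[/eqP]; rewrite oner_eq0. Qed.

HB.instance Definition _ := GRing.Zmodule_isNzRing.Build (quat R)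
  qmulA qmul1q qmulq1 qmulDl qmulDr quat1_neq0.

Lemma qscaleA a b q : qscale a (qscale b q) = qscale (a * b) q.
Proof. by case: q => *; congr Quat; rewrite /=; ring. Qed.

Lemma qscale1 : left_id 1 qscale.
Proof. by move=> [? ? ? ?]; congr Quat; rewrite /=; ring. Qed.

Lemma qscaleDr : right_distributive qscale +%R.
Proof. by move=> ? [? ? ? ?] [? ? ? ?]; congr Quat; rewrite /=; ring. Qed.

Lemma qscaleDl q : {morph qscale^~ q : a b / a + b}.
Proof. by case: q => *; move=> a b; congr Quat; rewrite /=; ring. Qed.

HB.instance Definition _ := GRing.Zmodule_isLmodule.Build R (quat R)
  qscaleA qscale1 qscaleDr qscaleDl.

Lemma qscaleAl (a : R) (p q : quat R) : a *: (p * q) = (a *: p) * q.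
Proof. by case: p => [? ? ? ?]; case: q => [? ? ? ?]; congr Quat; rewrite /=; ring. Qed.

HB.instance Definition _ := GRing.Lmodule_isLalgebra.Build R (quat R) qscaleAl.

Definition qconj (q : quat R) : quat R :=
  let: Quat t x y z := q in Quat t (- x) (- y) (- z).

Definition qnormsq (q : quat R) : R :=
  let: Quat t x y z := q in t ^+ 2 + x ^+ 2 + y ^+ 2 + z ^+ 2.

Definition qi : quat R := Quat 0 1 0 0.
Definition qj : quat R := Quat 0 0 1 0.
Definition qk : quat R := Quat 0 0 0 1.

(* e^{tQ}; only meant for Q a pure unit quaternion. *)
Definition qexp (t : R) (Q : quat R) : quat R := cos t *: (1 : quat R) + sin t *: Q.

Lemma qnormsqM p q : qnormsq (p * q) = qnormsq p * qnormsq q.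
Proof. by case: p => [? ? ? ?]; case: q => [? ? ? ?] /=; ring. Qed.

Lemma qnormsq_conj q : qnormsq (qconj q) = qnormsq q.
Proof. by case: q => [? ? ? ?] /=; ring. Qed.

Lemma qnormsq1 : qnormsq 1 = 1.
Proof. by rewrite /=; ring. Qed.

Lemma qmulVq q : qnormsq q = 1 -> qconj q * q = 1.
Proof.
by case: q => [? ? ? ?] /= h; congr Quat; rewrite -?h; ring.
Qed.

Lemma qmulqV q : qnormsq q = 1 -> q * qconj q = 1.
Proof.
by case: q => [? ? ? ?] /= h; congr Quat; rewrite -?h; ring.
Qed.

End Quaternions.

Definition SU2 (R : realType) : Type := set_type [set q : quat R | qnormsq q = 1].

HB.instance Definition _ (R : realType) :=
  Topological.copy (SU2 R) (set_type [set q : quat R | qnormsq q = 1]).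

Section SU2.
Variable R : realType.

Definition quat_of_SU2 (x : SU2 R) : quat R := set_val x.
Coercion quat_of_SU2 : SU2 >-> quat.

Definition mkSU2 (q : quat R) (h : qnormsq q = 1) : SU2 R := exist _ q (mem_set h).

Lemma SU2_norm (x : SU2 R) : qnormsq x = 1.
Proof. exact: (set_valP x). Qed.

Lemma SU2_inj (x y : SU2 R) : x = y :> quat R -> x = y.
Proof. exact: val_inj. Qed.

Lemma su2_mul_subproof (x y : SU2 R) : qnormsq ((x : quat R) * (y : quat R)) = 1.
Proof. by rewrite qnormsqM !SU2_norm mulr1. Qed.

Lemma su2_inv_subproof (x : SU2 R) : qnormsq (qconj x) = 1.
Proof. by rewrite qnormsq_conj SU2_norm. Qed.

Definition su2_mul (x y : SU2 R) : SU2 R := mkSU2 (su2_mul_subproof x y).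
Definition su2_inv (x : SU2 R) : SU2 R := mkSU2 (su2_inv_subproof x).
Definition su2_one : SU2 R := mkSU2 (qnormsq1 R).

Lemma su2_mulA : associative su2_mul.
Proof. by move=> x y z; apply: SU2_inj; exact: mulrA. Qed.

Lemma su2_mul1g : left_id su2_one su2_mul.
Proof. by move=> x; apply: SU2_inj; exact: mul1r. Qed.

Lemma su2_mulg1 : right_id su2_one su2_mul.
Proof. by move=> x; apply: SU2_inj; exact: mulr1. Qed.

Lemma su2_mulVg : left_inverse su2_one su2_inv su2_mul.
Proof. by move=> x; apply: SU2_inj; apply: qmulVq; exact: SU2_norm. Qed.

Lemma su2_mulgV : right_inverse su2_one su2_inv su2_mul.
Proof. by move=> x; apply: SU2_inj; apply: qmulqV; exact: SU2_norm. Qed.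

HB.instance Definition _ := isGroup.Build (SU2 R)
  su2_mulA su2_mul1g su2_mulg1 su2_mulVg su2_mulgV.

(* C(i): a unit quaternion is traceless as a matrix iff its real part is 0. *)
Definition Ci : set (SU2 R) := [set x : SU2 R | qre x = 0].

End SU2.
Arguments Ci {R}.

Inductive gterm (X : Type) : Type :=
| TGen of X
| TOne
| TMul of gterm X & gterm X
| TInv of gterm X.
Arguments TOne {X}.

HB.instance Definition _ (X : Type) := gen_eqMixin (gterm X).
HB.instance Definition _ (X : Type) := gen_choiceMixin (gterm X).

Declare Scope gterm_scope.
Delimit Scope gterm_scope with T.
Bind Scope gterm_scope with gterm.
Notation "x * y" := (TMul x y) : gterm_scope.
Notation "x ^-1" := (TInv x) : gterm_scope.
Notation "1" := TOne : gterm_scope.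

(* [x, y] = x y x^-1 y^-1, which is not the convention of the library's
   [~ x, y] = x^-1 y^-1 x y. *)
Definition tcomm (X : Type) (x y : gterm X) : gterm X := (x * y * x^-1 * y^-1)%T.

Section Presentation.
Variables (X : Type) (rel : gterm X -> gterm X -> Prop).

(* The group axioms are constructors, so terms modulo pres_eq form <X | rel>. *)
Inductive pres_eq : gterm X -> gterm X -> Prop :=
| PEq_rel u v : rel u v -> pres_eq u v
| PEq_refl u : pres_eq u u
| PEq_sym u v : pres_eq u v -> pres_eq v u
| PEq_trans u v w : pres_eq u v -> pres_eq v w -> pres_eq u w
| PEq_mul u u' v v' : pres_eq u u' -> pres_eq v v' -> pres_eq (u * v)%T (u' * v')%T
| PEq_inv u u' : pres_eq u u' -> pres_eq (u^-1)%T (u'^-1)%T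
| PEq_mulA u v w : pres_eq (u * (v * w))%T (u * v * w)%T
| PEq_mul1 u : pres_eq (1 * u)%T u
| PEq_mulr1 u : pres_eq (u * 1)%T u
| PEq_mulV u : pres_eq (u^-1 * u)%T 1%T
| PEq_mulrV u : pres_eq (u * u^-1)%T 1%T.

Definition pres_eqb (u v : gterm X) : bool := `[< pres_eq u v >].

Lemma pres_eqb_refl : reflexive pres_eqb.
Proof. by move=> u; apply/asboolP; exact: PEq_refl. Qed.

Lemma pres_eqb_sym : symmetric pres_eqb.
Proof. by move=> u v; apply/asboolP/asboolP; exact: PEq_sym. Qed.

Lemma pres_eqb_trans : transitive pres_eqb.
Proof.
by move=> v u w /asboolP uv /asboolP vw; apply/asboolP; exact: PEq_trans uv vw.
Qed.

Canonical pres_equiv := EquivRel pres_eqb pres_eqb_refl pres_eqb_sym pres_eqb_trans.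

Definition presented : Type := {eq_quot pres_equiv}.
HB.instance Definition _ := Choice.on presented.
HB.instance Definition _ := Quotient.on presented.

Definition pres_term (u : gterm X) : presented := \pi_presented u.

Lemma pres_termP u v : pres_term u = pres_term v <-> pres_eq u v.
Proof.
by split=> [/(@eqquotP _ _ {eq_quot pres_equiv})/asboolP //|uv];
  apply/(@eqquotP _ _ {eq_quot pres_equiv})/asboolP.
Qed.

Lemma repr_pres_term u : pres_eq (repr (pres_term u)) u.
Proof. by apply/pres_termP; rewrite /pres_term reprK. Qed.

Definition pres_mul (x y : presented) : presented := pres_term (repr x * repr y)%T.
Definition pres_inv (x : presented) : presented := pres_term ((repr x)^-1)%T.
Definition pres_one : presented := pres_term 1%T.

Lemma pres_mulE u v : pres_mul (pres_term u) (pres_term v) = pres_term (u * v)%T.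
Proof. by apply/pres_termP; apply: PEq_mul; exact: repr_pres_term. Qed.

Lemma pres_invE u : pres_inv (pres_term u) = pres_term (u^-1)%T.
Proof. by apply/pres_termP; apply: PEq_inv; exact: repr_pres_term. Qed.

Lemma pres_ind (P : presented -> Prop) :
  (forall u, P (pres_term u)) -> forall x, P x.
Proof. by move=> Pu x; rewrite -[x]reprK; exact: Pu. Qed.

Lemma pres_mulA : associative pres_mul.
Proof.
elim/pres_ind=> u; elim/pres_ind=> v; elim/pres_ind=> w.
by rewrite !pres_mulE; apply/pres_termP; exact: PEq_mulA.
Qed.

Lemma pres_mul1g : left_id pres_one pres_mul.
Proof. by elim/pres_ind=> u; rewrite pres_mulE; apply/pres_termP; exact: PEq_mul1. Qed.

Lemma pres_mulg1 : right_id pres_one pres_mul.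
Proof. by elim/pres_ind=> u; rewrite pres_mulE; apply/pres_termP; exact: PEq_mulr1. Qed.

Lemma pres_mulVg : left_inverse pres_one pres_inv pres_mul.
Proof.
by elim/pres_ind=> u; rewrite pres_invE pres_mulE; apply/pres_termP; exact: PEq_mulV.
Qed.

Lemma pres_mulgV : right_inverse pres_one pres_inv pres_mul.
Proof.
by elim/pres_ind=> u; rewrite pres_invE pres_mulE; apply/pres_termP; exact: PEq_mulrV.
Qed.

HB.instance Definition _ := isGroup.Build presented
  pres_mulA pres_mul1g pres_mulg1 pres_mulVg pres_mulgV.

Definition pres_gen (x : X) : presented := pres_term (TGen x).

End Presentation.

Inductive tangle_gen : Type := Ga | Gb | Gc | Gd | Gh | Gw | Gp.

Definition tangle_term (g : tangle_gen) : gterm tangle_gen := TGen g.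
Local Coercion tangle_term : tangle_gen >-> gterm.

Inductive tangle_rel : gterm tangle_gen -> gterm tangle_gen -> Prop :=
| Rel_c : tangle_rel Gc (Gp^-1 * Gb * Gp)
| Rel_d : tangle_rel Gd (Gc^-1 * Gb * Ga)
| Rel_lambda : tangle_rel (tcomm (Gb * Gh) Gp) 1
| Rel_w : tangle_rel (tcomm (Ga * Gp^-1) Gh) (Gh * Ga * Gw * (Ga^-1 * Gh^-1)).

(* pi_1 (B^3 \ (A_1 u A_2 u H u W u P)) *)
Definition tangle_group : groupType := presented tangle_rel.

Definition ma : tangle_group := pres_gen tangle_rel Ga.
Definition mb : tangle_group := pres_gen tangle_rel Gb.
Definition mc : tangle_group := pres_gen tangle_rel Gc.
Definition md : tangle_group := pres_gen tangle_rel Gd.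
Definition mh : tangle_group := pres_gen tangle_rel Gh.
Definition mw : tangle_group := pres_gen tangle_rel Gw.
Definition mp : tangle_group := pres_gen tangle_rel Gp.

Definition lambdaP : tangle_group := (mb * mh)%g.

Section CharacterVariety.
Variables (R : realType) (f : R -> R) (eps : R).

(* The exponents are only defined up to the choice of beta and Q, so the
   condition is imposed for all of them. *)
Definition perturbation_condition (phi : tangle_group -> SU2 R) : Prop :=
  forall (beta : R) (Q : SU2 R), Ci Q ->
    phi lambdaP = qexp beta Q :> quat R ->
    phi mp = qexp (eps * f beta) Q :> quat R.

Definition admissible (phi : {ptws tangle_group -> SU2 R}) : Prop :=
  {morph phi : x y / (x * y)%g} /\
  [/\ Ci (phi ma), Ci (phi mb), Ci (phi mc), Ci (phi md) & Ci (phi mh)] /\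
  phi mw = -1 :> quat R /\
  perturbation_condition phi.

(* The group is discrete, and finitely generated: pointwise convergence is the
   topology induced by SU(2)^7 through the values on generators. *)
Definition rep : topologicalType :=
  set_type [set phi : {ptws tangle_group -> SU2 R} | admissible phi].

Definition rep_fun (phi : rep) : tangle_group -> SU2 R := set_val phi.

Definition conjugate (phi psi : rep) : Prop :=
  exists g : SU2 R, forall x, rep_fun psi x = (g * rep_fun phi x * g^-1)%g.

Definition conjugateb (phi psi : rep) : bool := `[< conjugate phi psi >].

Lemma conjugateb_refl : reflexive conjugateb.
Proof. by move=> u; apply/asboolP; exists 1%g => x; rewrite invg1 mulg1 mul1g. Qed.

Lemma conjugateb_sym : symmetric conjugateb.
Proof.
suff H u v : conjugate u v -> conjugate v u.
  by move=> u v; apply/asboolP/asboolP; exact: H.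
by move=> [g E]; exists g^-1%g => x; rewrite E invgK !mulgA mulVg mul1g mulgVK.
Qed.

Lemma conjugateb_trans : transitive conjugateb.
Proof.
move=> v u w /asboolP[g E] /asboolP[g' E']; apply/asboolP; exists (g' * g)%g => x.
by rewrite E' E invgM !mulgA.
Qed.

Canonical conjugate_equiv :=
  EquivRel conjugateb conjugateb_refl conjugateb_sym conjugateb_trans.

Definition char_variety : topologicalType :=
  quotient_topology {eq_quot conjugate_equiv}.

Definition conj_class (phi : rep) : char_variety := \pi_char_variety phi.

Definition is_rho (beta : R) (phi : rep) : Prop :=
  let e := eps * f beta in
  rep_fun phi ma = qi R :> quat R /\
  rep_fun phi mb = qexp (pi / 2 + beta + e) (qk R) * qi R :> quat R /\
  rep_fun phi mc = qexp (pi / 2 + beta - e) (qk R) * qi R :> quat R /\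
  rep_fun phi md = qexp (- (2 * e)) (qk R) * qi R :> quat R /\
  rep_fun phi mh = - qj R * qexp (- e) (qk R) :> quat R /\
  rep_fun phi mp = qexp e (qk R) :> quat R /\
  rep_fun phi mw = -1 :> quat R.

End CharacterVariety.

Section Circle.
Variable R : realType.

Definition mod2pi (x y : R) : bool := `[< exists n : int, y = x + n%:~R * (2 * pi) >].

Lemma mod2pi_refl : reflexive mod2pi.
Proof. by move=> x; apply/asboolP; exists 0; rewrite mul0r addr0. Qed.

Lemma mod2pi_sym : symmetric mod2pi.
Proof.
by move=> x y; apply/asboolP/asboolP => -[n ->]; exists (- n); rewrite rmorphN; ring.
Qed.

Lemma mod2pi_trans : transitive mod2pi.
Proof.
move=> y x z /asboolP[n ->] /asboolP[m ->]; apply/asboolP.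
by exists (n + m); rewrite rmorphD /=; ring.
Qed.

Canonical mod2pi_equiv := EquivRel mod2pi mod2pi_refl mod2pi_sym mod2pi_trans.

Definition circle : topologicalType := quotient_topology {eq_quot mod2pi_equiv}.

Definition angle (x : R) : circle := \pi_circle x.

End Circle.

Definition homeomorphism (S T : topologicalType) (F : S -> T) : Prop :=
  continuous F /\ exists G : T -> S, [/\ continuous G, cancel F G & cancel G F].

Definition smooth (R : realType) (f : R -> R) : Prop :=
  forall (n : nat) (x : R), derivable (derive1n n f : R -> R) x 1.

(* Main.v *)
Require Import Defs.
From mathcomp Require Import all_boot all_order all_algebra.
From mathcomp Require Import generic_quotient.
From mathcomp Require Import all_classical all_reals all_analysis.
From mathcomp Require Import ring lra.

(* Any eps < 1 works. For a representation phi the relation defining w makes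
   X = phi(a p^-1) anticommute with the pure unit H = phi(h), so X is pure and
   H, X, Q := H X are orthonormal. Write phi(lambda_P) = e^{beta Q0} and
   phi(p) = e^{e Q0} with e = eps f(beta). If sin beta = 0 then e = 0 and Q0 is
   arbitrary; otherwise sin e <> 0, and tracelessness of phi(a) and phi(b) makes
   Q0 orthogonal to X and H, so that Q0 = +-Q and one may take Q0 = Q. As phi(a)
   is orthogonal to Q, a conjugation carries (phi(a), Q) to (i, k), and phi is
   then determined by beta. The real parts of lambda_P, ba and ha recover
   cos beta and sin beta, so beta |-> [rho(beta)] is a continuous bijection from
   the compact circle onto a space separated by continuous functions. *)

Set Implicit Arguments.
Unset Strict Implicit.
Unset Printing Implicit Defensive.

Import Order.TTheory GRing.Theory Num.Theory.
Import numFieldNormedType.Exports.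
Local Open Scope classical_set_scope.
Local Open Scope ring_scope.
Local Open Scope quotient_scope.

(** * Pointwise convergence, separation by real functions, compact-to-Hausdorff bijections *)

Section Topology.

Lemma continuous_initial (S : choiceType) (T Z : topologicalType) (f : S -> T)
    (g : Z -> initial_topology f) :
  continuous (f \o g) -> continuous g.
Proof.
move=> /continuousP cfg; apply/continuousP => A [B oB <-].
exact: (cfg B oB).
Qed.

Lemma continuous_ptws (U : Type) (V Z : topologicalType) (g : Z -> {ptws U -> V}) :
  (forall u, continuous (fun z => g z u)) -> continuous g.
Proof.
move=> cg z; apply/cvg_sup => u.
by apply: continuous_initial; exact: cg.
Qed.

Lemma ptws_eval_continuous (U : Type) (V : topologicalType) (u : U) :
  continuous (fun g : {ptws U -> V} => g u).
Proof.
exact: (@proj_continuous {classic U} (fun=> V) u).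
Qed.

(** Two points that cluster together have clustering images under each continuous [g], and these
    coincide because the real line is Hausdorff. *)
Lemma hausdorff_of_separating (R : realType) (T : topologicalType) :
  (forall x y : T, (forall g : T -> R, continuous g -> g x = g y) -> x = y) ->
  hausdorff_space T.
Proof.
move=> sep x y clxy; apply: sep => g cg.
apply: (@norm_hausdorff _ R) => A B /cg nA /cg nB.
by have [z [? ?]] := clxy _ _ nA nB; exists (g z).
Qed.

(** The preimage of a closed set under the inverse map is its image under [F], which is compact and
    therefore closed in a Hausdorff space. *)
Lemma compact_hausdorff_homeomorphism (S T : topologicalType) (F : S -> T) :
  compact [set: S] -> hausdorff_space T -> continuous F ->
  injective F -> (forall y, exists x, F x = y) -> homeomorphism F.
Proof.
move=> cS hT cF injF surjF; split=> //.
have /choice[G FG] := surjF.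
exists G; split=> //; last by move=> x; apply: injF.
apply/continuous_closedP => A cA.
have -> : G @^-1` A = F @` A.
  apply/seteqP; split=> [y /= Ay|_ [x Ax <-]]; first by exists (G y).
  by rewrite /= (_ : G (F x) = x)//; apply: injF.
apply: compact_closed => //; apply: continuous_compact.
  exact: continuous_subspaceT.
exact: (subclosed_compact cA cS).
Qed.

End Topology.

(** * Multiplicative maps between groups *)

Section GroupMorphisms.
Local Open Scope group_scope.
Variables (G H : groupType) (chi : G -> H).
Hypothesis chiM : {morph chi : x y / x * y}.

Lemma morph_one : chi 1 = 1.
Proof. by apply: (@mulgI H (chi 1)); rewrite -chiM !mulg1. Qed.

Lemma morph_inv x : chi x^-1 = (chi x)^-1.
Proof. by apply: (@mulgI H (chi x)); rewrite -chiM !mulgV morph_one. Qed.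

End GroupMorphisms.

(** * Universal property of a presented group *)

Section PresentedGroups.
Local Open Scope group_scope.
Variables (X : Type) (rel : gterm X -> gterm X -> Prop).

Fixpoint term_eval (G : groupType) (s : X -> G) (u : gterm X) : G :=
  match u with
  | TGen x => s x
  | TOne => 1
  | TMul u v => term_eval s u * term_eval s v
  | TInv u => (term_eval s u)^-1
  end.

(** Evaluation at a chosen representative makes sense for every [s]; it becomes a homomorphism once
    [s] respects the relations. *)
Definition pres_hom (G : groupType) (s : X -> G) (x : presented rel) : G :=
  term_eval s (repr x).

Lemma pres_termM u v :
  pres_term rel (TMul u v) = pres_term rel u * pres_term rel v.
Proof. by rewrite -pres_mulE. Qed.

Lemma pres_termV u : pres_term rel (TInv u) = (pres_term rel u)^-1.
Proof. by rewrite -pres_invE. Qed.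

Lemma pres_term_rel u v : rel u v -> pres_term rel u = pres_term rel v.
Proof. by move=> ruv; apply/pres_termP; exact: PEq_rel. Qed.

Section Hom.
Variables (G : groupType) (s : X -> G).
Hypothesis s_rel : forall u v, rel u v -> term_eval s u = term_eval s v.

(** Evaluation in a group respects every constructor of [pres_eq], the relations by hypothesis, so
    the choice of representative does not affect the value. *)
Lemma pres_homE u : pres_hom s (pres_term rel u) = term_eval s u.
Proof.
have E v w : pres_eq rel v w -> term_eval s v = term_eval s w.
  elim=> {v w} /= [v w /s_rel//|//|v w _ //|u' v w _ -> _ //
    |v v' w w' _ -> _ -> //|v v' _ -> //|u' v w|v|v|v|v].
  - by rewrite mulgA.
  - by rewrite mul1g.
  - by rewrite mulg1.
  - by rewrite mulVg.
  - by rewrite mulgV.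
exact/E/repr_pres_term.
Qed.

Lemma pres_homM : {morph pres_hom s : x y / x * y}.
Proof.
elim/pres_ind=> u; elim/pres_ind=> v.
by rewrite -pres_termM !pres_homE.
Qed.

End Hom.

Lemma morph_pres_ext (G : groupType) (phi psi : presented rel -> G) :
  {morph phi : x y / x * y} -> {morph psi : x y / x * y} ->
  (forall x, phi (pres_gen rel x) = psi (pres_gen rel x)) ->
  phi =1 psi.
Proof.
move=> phiM psiM E; elim/pres_ind.
elim=> [x||u IHu v IHv|u IHu].
- exact: E.
- by rewrite (_ : pres_term rel TOne = 1)// !morph_one.
- by rewrite pres_termM phiM psiM IHu IHv.
- by rewrite pres_termV !morph_inv ?IHu.
Qed.

End PresentedGroups.

(** * Periods and zeros of sine and cosine *)

Section Trigonometry.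
Variable R : realType.
Implicit Types (x y : R) (n : int).

Lemma periodicz (V : zmodType) (g : R -> V) (T : R) :
  periodic g T -> forall n x, g (x + n%:~R * T) = g x.
Proof.
move=> gT [] n x; first by rewrite -pmulrn mulr_natl periodicn.
by rewrite NegzE mulrNz -pmulrn mulNr mulr_natl -(periodicn gT n.+1) subrK.
Qed.

Lemma cos_periodic : periodic (@cos R) (2 * pi).
Proof. by move=> x; rewrite mulr_natl cosD2pi. Qed.

Lemma sin_periodic : periodic (@sin R) (2 * pi).
Proof. by move=> x; rewrite mulr_natl sinD2pi. Qed.

Lemma sin_zpi n : sin (n%:~R * pi) = 0 :> R.
Proof.
have h m : sin (m%:R * pi) = 0 :> R.
  elim: m => [|m IH]; first by rewrite mul0r sin0.
  by rewrite -natr1 mulrDl mul1r sinDpi IH oppr0.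
case: n => n; first by rewrite -pmulrn h.
by rewrite NegzE mulrNz -pmulrn mulNr sinN h oppr0.
Qed.

(** Let [d] be [y - x] reduced into [[0, 2 pi)]. Then [cos d = 1], whereas [d > 0] would give
    [sin (d / 2) > 0] and hence [cos d < 1]. *)
Lemma cos_sin_mod2pi x y :
  cos x = cos y -> sin x = sin y -> exists n, y = x + n%:~R * (2 * pi).
Proof.
move=> cxy sxy.
have p2 : 0 < 2 * pi :> R by rewrite mulr_gt0 ?pi_gt0.
pose n := Num.floor ((y - x) / (2 * pi)).
pose d := y - x - n%:~R * (2 * pi).
have d0 : 0 <= d by rewrite subr_ge0 -ler_pdivlMr// Num.Theory.ge_floor.
have d1 : d < 2 * pi.
  have -> : 2 * pi = (n + 1)%:~R * (2 * pi) - n%:~R * (2 * pi) :> R.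
    by rewrite intrD; ring.
  by rewrite ltrD2r -ltr_pdivrMr// floorD1_gt.
exists n; apply/eqP; rewrite -subr_eq0 opprD addrA -/d eq_le d0 andbT leNgt.
apply/negP => dgt0.
have cd : cos d = 1.
  have -> : d = (y - x) + (- n)%:~R * (2 * pi) by rewrite mulrNz mulNr.
  by rewrite (periodicz (@cos_periodic)) cosB cxy sxy -!expr2 cos2Dsin2.
have : 0 < sin (d / 2) by apply: sin_gt0_pi; apply/andP; split; lra.
have := cos_mulr2n (d / 2); have := cos2Dsin2 (d / 2).
have -> : (d / 2) *+ 2 = d by rewrite -mulr_natr divfK ?pnatr_eq0.
by rewrite cd -mulr_natr; nra.
Qed.

End Trigonometry.

(** * Pure unit quaternions: orthogonality, commutation, conjugation *)

Section QuaternionAlgebra.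
Variable R : realType.
Implicit Types (p q u v : quat R) (s t : R).

Lemma qmulE p q : p * q = qmul p q. Proof. by []. Qed.
Lemma qaddE p q : p + q = qadd p q. Proof. by []. Qed.
Lemma qoppE p : - p = qopp p. Proof. by []. Qed.
Lemma qscaleE t p : t *: p = qscale t p. Proof. by []. Qed.
Lemma qoneE : 1 = Quat 1 0 0 0 :> quat R. Proof. by []. Qed.
Lemma qzeroE : 0 = Quat 0 0 0 0 :> quat R. Proof. by []. Qed.

Definition quatE :=
  (qmulE, qaddE, qoppE, qscaleE, qoneE, qzeroE).

Lemma qnormsq_eq0 q : qnormsq q = 0 -> q = 0.
Proof.
case: q => t x y z /= h; rewrite qzeroE.
have [? ? ? ?] : [/\ t = 0, x = 0, y = 0 & z = 0] by split; nra.
by congr Quat.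
Qed.

Lemma qmul_eq0 p q : p * q = 0 -> p = 0 \/ q = 0.
Proof.
move=> pq0; have : qnormsq p * qnormsq q = 0.
  by rewrite -qnormsqM pq0 /=; ring.
by move=> /eqP; rewrite mulf_eq0 => /orP[]/eqP/qnormsq_eq0; [left|right].
Qed.

Lemma qre_mulC p q : qre (p * q) = qre (q * p).
Proof. by case: p; case: q => * /=; ring. Qed.

Lemma pure_sqr u : qre u = 0 -> qnormsq u = 1 -> u * u = -1.
Proof.
case: u => t x y z /= -> h; rewrite !quatE; congr Quat; rewrite /= -?h; ring.
Qed.

(** For pure quaternions [qre (u * v)] is minus the inner product, and orthogonal ones
    anticommute. *)
Lemma pure_anticomm u v :
  qre u = 0 -> qre v = 0 -> qre (u * v) = 0 -> v * u = - (u * v).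
Proof.
case: u => t x y z; case: v => t' x' y' z' /= -> -> h.
by rewrite !quatE; congr Quat => /=; lra.
Qed.

(** With [p = t + p'] and [p'] pure, [p u + u p = 2 t u - 2 <p', u>]; since [u] is a unit, both
    terms vanish. *)
Lemma anticomm_pure p u :
  qre u = 0 -> qnormsq u = 1 -> p * u = - (u * p) ->
  qre p = 0 /\ qre (p * u) = 0.
Proof.
case: p => t x y z; case: u => t' x' y' z' /= -> h.
by rewrite !quatE /= => -[? ? ? ?]; split; last lra; nra.
Qed.

(** Commutation factors [u^2 - v^2 = 0] as [(u - v) (u + v)], and quaternions have no zero
    divisors. *)
Lemma pure_comm u v :
  qre u = 0 -> qre v = 0 -> qnormsq u = 1 -> qnormsq v = 1 ->
  u * v = v * u -> u = v \/ u = - v.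
Proof.
move=> u0 v0 nu nv uv.
have : (u - v) * (u + v) = 0.
  by rewrite mulrDr !mulrBl !pure_sqr// uv addrA subrK subrr.
by move=> /qmul_eq0[/subr0_eq|/eqP]; [left|rewrite addr_eq0 => /eqP; right].
Qed.

Lemma qscaleAr (c : R) p q : c *: (p * q) = p * (c *: q).
Proof.
by case: p => ????; case: q => ????; rewrite !quatE; congr Quat => /=; ring.
Qed.

(** Dividing by the norm keeps the intertwining relation. The scalar [c] is recorded so that further
    commutation properties of [p] pass to [g]. *)
Lemma normalize_conj p u v : p != 0 -> p * u = v * p ->
  exists2 g, qnormsq g = 1 & g * u = v * g /\ exists c, g = c *: p.
Proof.
move=> p0 pu.
have np : 0 < qnormsq p.
  rewrite lt_def; apply/andP; split.
    by apply: contra_neq p0; exact: qnormsq_eq0.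
  by case: p {p0 pu} => t x y z /=; rewrite !addr_ge0 ?sqr_ge0.
exists ((Num.sqrt (qnormsq p))^-1 *: p).
  have : (Num.sqrt (qnormsq p))^-1 ^+ 2 * qnormsq p = 1.
    by rewrite exprVn sqr_sqrtr ?mulVf ?gt_eqF// ltW.
  case: p {p0 pu np} => t x y z; set c := _^-1; rewrite quatE /= => <-; ring.
split; last by eexists.
by rewrite -scalerAl pu qscaleAr.
Qed.

Lemma qi_sqr : qi R * qi R = -1.
Proof. by apply: pure_sqr => //=; ring. Qed.

Lemma qk_sqr : qk R * qk R = -1.
Proof. by apply: pure_sqr => //=; ring. Qed.

(* [1 - v u] conjugates [u] to [v]; it vanishes only for [u = - v]. *)
Lemma pure_frame u v :
  qre u = 0 -> qre v = 0 -> qnormsq u = 1 -> qnormsq v = 1 -> qre (u * v) = 0 ->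
  exists2 g, qnormsq g = 1 & g * u = qi R * g /\ g * v = qk R * g.
Proof.
move=> u0 v0 nu nv uv0.
have [g1 ng1 g1u] : exists2 g, qnormsq g = 1 & g * u = qi R * g.
  have [E|E] := eqVneq (1 - qi R * u) 0.
    (* Degenerate case [u = - i]: conjugation by [j] sends [- i] to [i]. *)
    exists (qj R); first by rewrite /=; ring.
    have -> : u = - qi R.
      move/subr0_eq: E => /(congr1 ( *%R (qi R))).
      by rewrite mulrA qi_sqr mulr1 mulN1r => ->; rewrite opprK.
    by rewrite !quatE; congr Quat => /=; ring.
  have [|g ng [gu _]] := @normalize_conj _ u (qi R) E.
    rewrite mulrBl mulrBr mul1r mulr1 -mulrA pure_sqr// mulrA qi_sqr.
    by rewrite mulrN1 mulN1r !opprK addrC.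
  by exists g.
pose w := g1 * v * qconj g1.
have g1V : qconj g1 * g1 = 1 by apply: qmulVq.
have g1v : g1 * v = w * g1 by rewrite /w -mulrA g1V mulr1.
have nw : qnormsq w = 1 by rewrite !qnormsqM qnormsq_conj ng1 nv !mul1r.
have w0 : qre w = 0 by rewrite qre_mulC mulrA g1V mul1r.
have iw0 : qre (qi R * w) = 0.
  rewrite /w 2!mulrA qre_mulC !mulrA -[qconj g1 * _ * _]mulrA -g1u.
  by rewrite mulrA g1V mul1r.
clearbody w.
have wi : w * qi R = - (qi R * w) by apply: pure_anticomm.
(* The second rotation must fix [i]. Both [k] and [w] anticommute with [i], so [1 - k w] commutes
   with it; if [w = - k], then [i] itself serves. *)
have [g2 ng2 [g2w g2i]] : exists2 g, qnormsq g = 1 &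
    g * w = qk R * g /\ g * qi R = qi R * g.
  have [E|E] := eqVneq (1 - qk R * w) 0.
    exists (qi R); first by rewrite /=; ring.
    split=> //.
    have -> : w = - qk R.
      move/subr0_eq: E => /(congr1 ( *%R (qk R))).
      by rewrite mulrA qk_sqr mulr1 mulN1r => ->; rewrite opprK.
    by rewrite !quatE; congr Quat => /=; ring.
  have [|g ng [gw [c gE]]] := @normalize_conj _ w (qk R) E.
    rewrite mulrBl mulrBr mul1r mulr1 -mulrA pure_sqr// mulrA qk_sqr.
    by rewrite mulrN1 mulN1r !opprK addrC.
  exists g => //; split=> //; rewrite gE -scalerAl.
  rewrite -qscaleAr; congr (c *: _); rewrite mulrBl mulrBr mul1r mulr1.
  rewrite -mulrA wi mulrN mulrA.
  have -> : qk R * qi R = - (qi R * qk R) by rewrite pure_anticomm //=; ring.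
  by rewrite mulNr opprK mulrA.
exists (g2 * g1); first by rewrite qnormsqM ng1 ng2 mul1r.
split; first by rewrite -mulrA g1u mulrA g2i mulrA.
by rewrite -mulrA g1v mulrA g2w mulrA.
Qed.

End QuaternionAlgebra.

(** * The circle [e^{tk}] and its coset [e^{tk} i] *)

Section RotationsAboutK.
Variable R : realType.
Implicit Types s t : R.

Lemma expk_subproof t : qnormsq (Quat (cos t) 0 0 (sin t)) = 1.
Proof. by rewrite /= -(cos2Dsin2 t); ring. Qed.

Lemma eij_subproof t : qnormsq (Quat 0 (cos t) (sin t) 0) = 1.
Proof. by rewrite /= -(cos2Dsin2 t); ring. Qed.

(** All values of the family lie in this circle or in the coset [eij], whose union is closed under
    products and inverses, so identities in the group reduce to arithmetic of angles. *)
Definition expk t : SU2 R := mkSU2 (expk_subproof t).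
Definition eij t : SU2 R := mkSU2 (eij_subproof t).

Lemma expk_val t : quat_of_SU2 (expk t) = Quat (cos t) 0 0 (sin t).
Proof. by []. Qed.

Lemma eij_val t : quat_of_SU2 (eij t) = Quat 0 (cos t) (sin t) 0.
Proof. by []. Qed.

Lemma SU2M (x y : SU2 R) : quat_of_SU2 (x * y)%g = (x : quat R) * (y : quat R).
Proof. by []. Qed.

Lemma SU2V (x : SU2 R) : quat_of_SU2 (x^-1)%g = qconj x.
Proof. by []. Qed.

Lemma expkE t : expk t = qexp t (qk R) :> quat R.
Proof. by rewrite ?expk_val ?eij_val /qexp !quatE; congr Quat => /=; ring. Qed.

Lemma eijE t : eij t = qexp t (qk R) * qi R :> quat R.
Proof. by rewrite ?expk_val ?eij_val /qexp !quatE; congr Quat => /=; ring. Qed.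

Lemma expkM s t : (expk s * expk t)%g = expk (s + t).
Proof.
apply: SU2_inj; rewrite SU2M ?expk_val ?eij_val quatE /= cosD sinD.
by congr Quat => /=; ring.
Qed.

Lemma expkV t : (expk t)^-1%g = expk (- t).
Proof. by apply: SU2_inj; rewrite SU2V ?expk_val ?eij_val /= !oppr0 cosN sinN. Qed.

(** Moving [i] past [e^{tk}] reverses the sign of [t], and [i^2 = -1] contributes the half turn
    [pi]. *)
Lemma eijM s t : (eij s * eij t)%g = expk (pi + s - t).
Proof.
apply: SU2_inj; rewrite SU2M ?expk_val ?eij_val quatE /=.
rewrite -[pi + s - t]addrA [pi + _]addrC cosDpi sinDpi cosB sinB.
by congr Quat => /=; ring.
Qed.

Lemma expk_eij s t : (expk s * eij t)%g = eij (s + t).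
Proof.
apply: SU2_inj; rewrite SU2M ?expk_val ?eij_val quatE /= cosD sinD.
by congr Quat => /=; ring.
Qed.

Lemma eij_expk s t : (eij s * expk t)%g = eij (s - t).
Proof.
apply: SU2_inj; rewrite SU2M ?expk_val ?eij_val quatE /= cosB sinB.
by congr Quat => /=; ring.
Qed.

Lemma eijV t : (eij t)^-1%g = eij (t + pi).
Proof. by apply: SU2_inj; rewrite SU2V ?expk_val ?eij_val /= cosDpi sinDpi !oppr0. Qed.

Lemma expkD2pi t : expk (t + 2 * pi) = expk t.
Proof. by apply: SU2_inj; rewrite !expk_val cos_periodic sin_periodic. Qed.

Lemma eijD2pi t : eij (t + 2 * pi) = eij t.
Proof. by apply: SU2_inj; rewrite !eij_val cos_periodic sin_periodic. Qed.

Lemma expk0 : expk 0 = 1%g.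
Proof. by apply: SU2_inj; rewrite expk_val cos0 sin0. Qed.

Lemma expkpi : expk pi = -1 :> quat R.
Proof. by rewrite expk_val cospi sinpi quatE /=; congr Quat; rewrite oppr0. Qed.

End RotationsAboutK.

(** * The representations of the family, on generators *)

Section Rho.
Variables (R : realType) (f : R -> R) (eps : R).
Implicit Types beta : R.

(** The value at [Gh] is [- j e^{-ek}], since [j e^{-ek} = e^{ek} j] and [- j = e^{-(pi/2)k} i]. *)
Definition rho_gen beta (x : tangle_gen) : SU2 R :=
  let e := eps * f beta in
  match x with
  | Ga => eij 0
  | Gb => eij (pi / 2 + beta + e)
  | Gc => eij (pi / 2 + beta - e)
  | Gd => eij (- (2 * e))
  | Gh => eij (e - pi / 2)
  | Gw => expk pi
  | Gp => expk e
  end.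

Definition rho_hom beta : {ptws tangle_group -> SU2 R} :=
  pres_hom (rho_gen beta).

Definition anglesE := (expkM, expkV, eijM, expk_eij, eij_expk, eijV).

Lemma rho_gen_rel beta u v :
  tangle_rel u v ->
  term_eval (rho_gen beta) u = term_eval (rho_gen beta) v.
Proof.
case=> /=; rewrite !anglesE.
- by congr eij; lra.
(* The product on the right has angle [2 * pi - 2 * e], one full turn more than the angle of
   [Gd]. *)
- rewrite -[LHS]eijD2pi; congr eij; lra.
- by rewrite -expk0; congr expk; lra.
- by congr expk; lra.
Qed.

End Rho.

(** * Continuity of maps into the quaternions and SU(2) *)

Section Continuity.
Variables (R : realType) (Z : topologicalType).

Lemma continuous_pair (S T : topologicalType) (g : Z -> S) (h : Z -> T) :
  continuous g -> continuous h -> continuous (fun z => (g z, h z)).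
Proof. by move=> cg ch z; apply: cvg_pair; [exact: cg|exact: ch]. Qed.

Lemma continuous_fst_comp (S T : topologicalType) (g : Z -> S * T) :
  continuous g -> continuous (fun z => (g z).1).
Proof. by move=> cg z; apply: (continuous_comp (cg z)); exact: cvg_fst. Qed.

Lemma continuous_snd_comp (S T : topologicalType) (g : Z -> S * T) :
  continuous g -> continuous (fun z => (g z).2).
Proof. by move=> cg z; apply: (continuous_comp (cg z)); exact: cvg_snd. Qed.

Lemma continuous_quat (g : Z -> quat R) :
  continuous g <->
  [/\ continuous (fun z => qre (g z)), continuous (fun z => qix (g z)),
      continuous (fun z => qjy (g z)) & continuous (fun z => qkz (g z))].
Proof.
split=> [cg|[c0 c1 c2 c3]]; last first.
  apply: continuous_initial.
  exact: continuous_pair (continuous_pair (continuous_pair c0 c1) c2) c3.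
have cv : continuous (fun z => quat_coord (g z)).
  by move=> z; apply: (continuous_comp (cg z)); exact: initial_continuous.
split.
- exact: continuous_fst_comp (continuous_fst_comp (continuous_fst_comp cv)).
- exact: continuous_snd_comp (continuous_fst_comp (continuous_fst_comp cv)).
- exact: continuous_snd_comp (continuous_fst_comp cv).
- exact: continuous_snd_comp cv.
Qed.

Lemma quat_of_SU2_continuous : continuous (@quat_of_SU2 R).
Proof. exact: initial_continuous. Qed.

Lemma continuous_SU2 (g : Z -> SU2 R) :
  continuous g <-> continuous (fun z => quat_of_SU2 (g z)).
Proof.
split=> [cg z|cg]; last exact: continuous_initial.
by apply: (continuous_comp (cg z)); exact: quat_of_SU2_continuous.
Qed.

Lemma continuous_SU2_mul (g h : Z -> SU2 R) :
  continuous g -> continuous h -> continuous (fun z => (g z * h z)%g).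
Proof.
move=> /continuous_SU2/continuous_quat[g0 g1 g2 g3].
move=> /continuous_SU2/continuous_quat[h0 h1 h2 h3].
apply/continuous_SU2.
have -> : (fun z => quat_of_SU2 (g z * h z)%g) = fun z =>
    Quat (qre (g z) * qre (h z) - qix (g z) * qix (h z)
            - qjy (g z) * qjy (h z) - qkz (g z) * qkz (h z))
         (qre (g z) * qix (h z) + qix (g z) * qre (h z)
            + qjy (g z) * qkz (h z) - qkz (g z) * qjy (h z))
         (qre (g z) * qjy (h z) - qix (g z) * qkz (h z)
            + qjy (g z) * qre (h z) + qkz (g z) * qix (h z))
         (qre (g z) * qkz (h z) + qix (g z) * qjy (h z)
            - qjy (g z) * qix (h z) + qkz (g z) * qre (h z)).
  apply/funext => z; rewrite SU2M quatE; case: (quat_of_SU2 (g z)) => ????.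
  by case: (quat_of_SU2 (h z)).
pose M a b (ca : continuous a) (cb : continuous b) (z : Z) :=
  @cvgM R Z (nbhs z) _ _ _ _ _ (ca z) (cb z).
apply/continuous_quat; split=> z /=.
- apply: cvgB; last exact: M _ _ g3 h3 z.
  apply: cvgB; last exact: M _ _ g2 h2 z.
  apply: cvgB; last exact: M _ _ g1 h1 z.
  exact: M _ _ g0 h0 z.
- apply: cvgB; last exact: M _ _ g3 h2 z.
  apply: cvgD; last exact: M _ _ g2 h3 z.
  apply: cvgD; last exact: M _ _ g1 h0 z.
  exact: M _ _ g0 h1 z.
- apply: cvgD; last exact: M _ _ g3 h1 z.
  apply: cvgD; last exact: M _ _ g2 h0 z.
  apply: cvgB; last exact: M _ _ g1 h3 z.
  exact: M _ _ g0 h2 z.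
- apply: cvgD; last exact: M _ _ g3 h0 z.
  apply: cvgB; last exact: M _ _ g2 h1 z.
  apply: cvgD; last exact: M _ _ g1 h2 z.
  exact: M _ _ g0 h3 z.
Qed.

Lemma continuous_SU2_inv (g : Z -> SU2 R) :
  continuous g -> continuous (fun z => (g z)^-1%g).
Proof.
move=> /continuous_SU2/continuous_quat[g0 g1 g2 g3].
apply/continuous_SU2.
have -> : (fun z => quat_of_SU2 (g z)^-1%g) = fun z =>
    Quat (qre (g z)) (- qix (g z)) (- qjy (g z)) (- qkz (g z)).
  by apply/funext => z; rewrite SU2V; case: (quat_of_SU2 (g z)).
by apply/continuous_quat; split=> z /=;
  [exact: g0|exact: cvgN (g1 z)|exact: cvgN (g2 z)|exact: cvgN (g3 z)].
Qed.

Lemma continuous_term_eval (X : Type) (s : Z -> X -> SU2 R) u :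
  (forall x, continuous (fun z => s z x)) ->
  continuous (fun z => term_eval (s z) u).
Proof.
move=> cs; elim: u => [x||u IHu v IHv|u IHu] /=.
- exact: cs.
- by move=> z; exact: cvg_cst.
- exact: continuous_SU2_mul.
- exact: continuous_SU2_inv.
Qed.

Lemma continuous_expk (t : Z -> R) :
  continuous t -> continuous (fun z => expk (t z)).
Proof.
move=> ct; apply/continuous_SU2/continuous_quat; split=> z /=.
- by apply: (continuous_comp (ct z)); exact: continuous_cos.
- exact: cvg_cst.
- exact: cvg_cst.
- by apply: (continuous_comp (ct z)); exact: continuous_sin.
Qed.

Lemma continuous_eij (t : Z -> R) :
  continuous t -> continuous (fun z => eij (t z)).
Proof.
move=> ct; apply/continuous_SU2/continuous_quat; split=> z /=.
- exact: cvg_cst.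
- by apply: (continuous_comp (ct z)); exact: continuous_cos.
- by apply: (continuous_comp (ct z)); exact: continuous_sin.
- exact: cvg_cst.
Qed.

End Continuity.

(** * Generators and relations of the tangle group *)

Section TangleGroup.
Local Open Scope group_scope.

Lemma mcE : mc = mp^-1 * mb * mp.
Proof. by have := pres_term_rel Rel_c; rewrite !(pres_termM, pres_termV). Qed.

Lemma mdE : md = mc^-1 * mb * ma.
Proof. by have := pres_term_rel Rel_d; rewrite !(pres_termM, pres_termV). Qed.

Lemma mwE : ma * mp^-1 * mh * (ma * mp^-1)^-1 * mh^-1 =
  mh * ma * mw * (ma^-1 * mh^-1).
Proof. by have := pres_term_rel Rel_w; rewrite !(pres_termM, pres_termV). Qed.

(* The quaternion [h a p^-1] is the common axis of [lambda_P] and [p]. *)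
Definition axis : tangle_group := mh * ma * mp^-1.

(** These five elements generate: [mh] comes from [axis], then [mb] from [lambdaP], and the
    relations give [mc] and [md]. They are the elements whose images are known once the axis is
    normalized. *)
Lemma tangle_morph_ext (G : groupType) (phi psi : tangle_group -> G) :
  {morph phi : x y / x * y} -> {morph psi : x y / x * y} ->
  phi ma = psi ma -> phi mp = psi mp -> phi mw = psi mw ->
  phi lambdaP = psi lambdaP -> phi axis = psi axis -> phi =1 psi.
Proof.
move=> phiM psiM Ea Ep Ew El Ek.
have V (x : tangle_group) : phi x = psi x -> phi x^-1 = psi x^-1.
  by rewrite !morph_inv// => ->.
have M x y : phi x = psi x -> phi y = psi y -> phi (x * y) = psi (x * y).
  by rewrite phiM psiM => -> ->.
have Eh : phi mh = psi mh.
  have -> : mh = axis * mp * ma^-1 by rewrite /axis mulgVK mulgK.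
  exact: M (M _ _ Ek Ep) (V _ Ea).
have Eb : phi mb = psi mb.
  have -> : mb = lambdaP * mh^-1 by rewrite /lambdaP mulgK.
  exact: M El (V _ Eh).
have Ec : phi mc = psi mc by rewrite mcE; exact: M (M _ _ (V _ Ep) Eb) Ep.
have Ed : phi md = psi md by rewrite mdE; exact: M (M _ _ (V _ Ec) Eb) Ea.
by apply: morph_pres_ext => //; case.
Qed.

End TangleGroup.

(** * The family satisfies the defining conditions and is continuous in the angle *)

Section Family.
Variables (R : realType) (f : R -> R) (eps : R).
Hypotheses (f_cont : continuous f) (f0 : f 0 = 0)
  (f_odd : forall x : R, f (- x) = - f x) (f_periodic : periodic f (2 * pi)).
Implicit Types beta : R.

Lemma f_cos_sin x y : cos x = cos y -> sin x = sin y -> f x = f y.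
Proof.
by move=> cxy sxy; have [n ->] := cos_sin_mod2pi cxy sxy; rewrite periodicz.
Qed.

Lemma f_pi : f pi = 0.
Proof.
have := f_periodic (- pi); rewrite f_odd (_ : - pi + _ = pi); last by ring.
by move=> ?; lra.
Qed.

(** Such an [x] is congruent to [0] or [pi] modulo [2 * pi], and [f] vanishes at both. *)
Lemma f_sin0 x : sin x = 0 -> f x = 0.
Proof.
move=> sx0; have /eqP := sin0cos1 sx0.
rewrite eqr_norml ler01 andbT => /orP[]/eqP cx.
- by rewrite -f0; apply: f_cos_sin; rewrite ?cos0 ?sin0.
- by rewrite -f_pi; apply: f_cos_sin; rewrite ?cospi ?sinpi.
Qed.

Local Notation rho := (rho_hom f eps).

Lemma rho_homM beta : {morph rho beta : x y / (x * y)%g}.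
Proof. exact: pres_homM (@rho_gen_rel _ _ _ _). Qed.

Lemma rho_hom_gen beta x :
  rho beta (pres_gen tangle_rel x) = rho_gen f eps beta x.
Proof. by rewrite [LHS]pres_homE //; exact: rho_gen_rel. Qed.

(** In the product of the values at [mb] and [mh] the terms [eps * f beta] cancel, leaving [beta]
    plus a full turn. *)
Lemma rho_hom_lambda beta : rho beta lambdaP = expk beta.
Proof.
rewrite rho_homM !rho_hom_gen /= eijM -[RHS]expkD2pi; congr expk; lra.
Qed.

Lemma rho_hom_axis beta : rho beta axis = expk (pi / 2).
Proof.
apply: (@mulIg _ (rho beta mp)); rewrite -rho_homM /axis mulgVK rho_homM.
by rewrite !rho_hom_gen /= eijM expkM; congr expk; lra.
Qed.

(** If [sin b = 0], both sides equal 1. Otherwise [Q] is [k] or [- k], and [beta] is [b] or [- b]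
    modulo [2 * pi]; oddness of [f] absorbs the sign. *)
Lemma qexp_perturbed b beta (Q : SU2 R) : Ci Q ->
  expk beta = qexp b Q :> quat R ->
  expk (eps * f beta) = qexp (eps * f b) Q :> quat R.
Proof.
have := SU2_norm Q; rewrite /Ci /=.
case: (quat_of_SU2 Q) => t x y z /= nQ t0.
rewrite !expk_val /qexp !quatE /= => -[cE xE yE zE].
have cE' : cos beta = cos b by rewrite cE t0; ring.
have {cE}sE : sin beta ^+ 2 = sin b ^+ 2 by rewrite !sin2cos2 cE'.
have [sb0|sb0] := eqVneq (sin b) 0.
  have sbeta0 : sin beta = 0.
    by apply/eqP; rewrite -sqrf_eq0 sE sb0 expr0n.
  by rewrite !f_sin0// !mulr0 cos0 sin0 t0; congr Quat => /=; ring.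
have x0 : x = 0.
  by apply/eqP; move/eqP: xE; rewrite mulr0 add0r eq_sym mulf_eq0 (negbTE sb0).
have y0 : y = 0.
  by apply/eqP; move/eqP: yE; rewrite mulr0 add0r eq_sym mulf_eq0 (negbTE sb0).
rewrite {}x0 {}y0 {}t0 in nQ zE *.
have /eqP : z ^+ 2 = 1 by rewrite -nQ; ring.
rewrite sqrf_eq1 => /orP[]/eqP z1; rewrite {}z1 in zE *.
  have -> : f beta = f b by apply: f_cos_sin => //; rewrite zE; ring.
  by congr Quat => /=; ring.
have -> : f beta = - f b.
  by rewrite -f_odd; apply: f_cos_sin; rewrite ?cosN ?sinN// zE; ring.
by rewrite mulrN cosN sinN; congr Quat => /=; ring.
Qed.

Lemma rho_admissible beta : admissible f eps (rho beta).
Proof.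
split; first exact: rho_homM.
split; first by split; rewrite rho_hom_gen.
split; first by rewrite rho_hom_gen /= expkpi.
move=> b Q CQ; rewrite rho_hom_lambda rho_hom_gen /=.
exact: qexp_perturbed.
Qed.

Definition rho_rep beta : rep f eps :=
  exist _ (rho beta) (mem_set (rho_admissible beta)).

Lemma rho_repE beta : rep_fun (rho_rep beta) = rho beta.
Proof. by []. Qed.

Lemma is_rho_rep beta : is_rho beta (rho_rep beta).
Proof.
rewrite /is_rho rho_repE !rho_hom_gen /= !eijE expkE expkpi.
split; first by rewrite /qexp cos0 sin0 scale1r scale0r addr0 mul1r.
do 3 split=> //.
split; last by [].
rewrite -eijE eij_val cosBpihalf sinBpihalf /qexp cosN sinN !quatE.
by congr Quat => /=; ring.
Qed.

Lemma rho_rep_continuous : continuous rho_rep.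
Proof.
apply: continuous_initial; apply: continuous_ptws => x.
(* The value at [x] is the evaluation of a term independent of the angle, so the generators
   suffice. *)
apply: continuous_term_eval (fun b => rho_gen f eps b) _ _ => g.
have ce : continuous (fun b => eps * f b).
  by move=> b; apply: cvgM; [exact: cvg_cst|exact: f_cont].
have cp : continuous (fun b : R => pi / 2 + b).
  by move=> b; apply: cvgD; [exact: cvg_cst|exact: cvg_id].
case: g => /=; (apply: continuous_eij || apply: continuous_expk) => b.
- exact: cvg_cst.
- by apply: cvgD; [exact: cp|exact: ce].
- by apply: cvgB; [exact: cp|exact: ce].
- by apply: cvgN; apply: cvgM; [exact: cvg_cst|exact: ce].
- by apply: cvgB; [exact: ce|exact: cvg_cst].
- exact: cvg_cst.
- exact: ce.
Qed.

End Family.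

(** * Exponentials of pure unit quaternions and polar form *)

Section Exponential.
Variable R : realType.
Implicit Types (p q u v : quat R) (t : R).

Lemma qre_mul_qexp p t q :
  qre (p * qexp t q) = cos t * qre p + sin t * qre (p * q).
Proof. by case: p => ????; case: q => ????; rewrite /qexp !quatE /=; ring. Qed.

Lemma qreN q : qre (- q) = - qre q.
Proof. by []. Qed.

Lemma qexpN t q : qexp t (- q) = qexp (- t) q.
Proof. by rewrite /qexp cosN sinN scalerN scaleNr. Qed.

Lemma qexp0 q : qexp 0 q = 1.
Proof. by rewrite /qexp cos0 sin0 scale1r scale0r addr0. Qed.

Lemma intertwine_qexp p u v t :
  p * u = v * p -> p * qexp t u = qexp t v * p.
Proof.
move=> puv; rewrite /qexp mulrDr mulrDl -qscaleAr mulr1 -qscaleAr puv.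
by rewrite -!scalerAl mul1r.
Qed.

Lemma Ci_qconj (u : SU2 R) : Ci u -> qconj u = - quat_of_SU2 u.
Proof.
by rewrite /Ci /=; case: (quat_of_SU2 u) => ???? /= ->; rewrite quatE /qopp oppr0.
Qed.

Lemma SU2_conj_eq (g u v : SU2 R) :
  quat_of_SU2 g * quat_of_SU2 u = quat_of_SU2 v * quat_of_SU2 g ->
  (g * u * g^-1)%g = v.
Proof.
move=> guv; have -> : (g * u)%g = (v * g)%g by apply: SU2_inj; rewrite !SU2M.
by rewrite mulgK.
Qed.

Lemma mkSU2_val q (nq : qnormsq q = 1) : quat_of_SU2 (mkSU2 nq) = q.
Proof. by []. Qed.

(** This makes the perturbation condition applicable to an arbitrary value of [lambdaP]. *)
Lemma SU2_polar (u : SU2 R) :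
  exists t, exists2 Q : SU2 R, Ci Q & u = qexp t Q :> quat R.
Proof.
have := SU2_norm u; case E : (quat_of_SU2 u) => [t x y z] /= n1.
have tint : -1 <= t <= 1 by apply/andP; split; nra.
exists (acos t); rewrite /qexp acosK ?in_itv//= sin_acos//.
set r := Num.sqrt _.
have r2 : r ^+ 2 = 1 - t ^+ 2 by rewrite sqr_sqrtr//; nra.
have [r0|r0] := eqVneq r 0.
  have [? ? ?] : [/\ x = 0, y = 0 & z = 0] by rewrite r0 in r2; split; nra.
  (* The quaternion is real, so any pure unit quaternion can be the axis. *)
  subst x y z; exists (eij 0) => //.
  by rewrite eij_val !quatE; congr Quat => /=; rewrite r0; ring.
have nQ : qnormsq (Quat 0 (x / r) (y / r) (z / r)) = 1.
  have e : 1 - t ^+ 2 = x ^+ 2 + y ^+ 2 + z ^+ 2 by rewrite -n1; ring.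
  have -> : qnormsq (Quat 0 (x / r) (y / r) (z / r)) =
      (x ^+ 2 + y ^+ 2 + z ^+ 2) / r ^+ 2 by rewrite /=; field.
  by rewrite -e -r2 divff// sqrf_eq0.
exists (mkSU2 nQ) => //; rewrite mkSU2_val.
by rewrite !quatE; congr Quat => /=; field.
Qed.

End Exponential.

(** * Every representation is conjugate to a member of the family *)

Section Representations.
Variables (R : realType) (f : R -> R) (eps : R).
Hypotheses (f_cont : continuous f) (f0 : f 0 = 0)
  (f_le1 : forall x : R, `|f x| <= 1)
  (f_odd : forall x : R, f (- x) = - f x) (f_periodic : periodic f (2 * pi))
  (f_neq0 : forall x : R, (forall n : int, x <> n%:~R * pi) -> f x <> 0)
  (eps_lt1 : 0 < eps < 1).
Implicit Types (beta : R) (phi : rep f eps).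

Lemma rep_funP phi : admissible f eps (rep_fun phi).
Proof. exact: (set_valP phi). Qed.

Lemma rep_funM phi : {morph rep_fun phi : x y / (x * y)%g}.
Proof. by have [] := rep_funP phi. Qed.

Lemma rep_funV phi x : rep_fun phi x^-1%g = (rep_fun phi x)^-1%g.
Proof. exact/morph_inv/rep_funM. Qed.

Lemma perturbation_small x : -1 < eps * f x < 1.
Proof.
have /andP[e0 e1] := eps_lt1; rewrite -ltr_norml normrM gtr0_norm//.
by have := f_le1 x; have := normr_ge0 (f x); nra.
Qed.

Lemma cos_perturbation_gt0 x : 0 < cos (eps * f x).
Proof.
have := perturbation_small x; have := pi_ge2 R => ? /andP[? ?].
by apply: cos_gt0_pihalf; apply/andP; split; lra.
Qed.

(** Here [eps * f x] is nonzero and lies in [(-1, 1)], inside [(- pi, pi)]. *)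
Lemma sin_perturbation_neq0 x : sin x != 0 -> sin (eps * f x) != 0.
Proof.
move=> sx; have fx : f x <> 0.
  by apply: f_neq0 => n xE; move: sx; rewrite xE sin_zpi eqxx.
have := perturbation_small x; have := pi_ge2 R => ? /andP[? ?].
have /eqP : eps * f x <> 0.
  by move/eqP; rewrite mulf_eq0 gt_eqF/= => [/eqP|]; case/andP: eps_lt1.
rewrite neq_lt => /orP[?|?].
  rewrite -oppr_eq0 -sinN gt_eqF// sin_gt0_pi//; apply/andP; split; lra.
by rewrite gt_eqF// sin_gt0_pi//; apply/andP; split; lra.
Qed.

Lemma common_axis phi : exists beta,
  let Q : quat R := rep_fun phi axis in
  [/\ qre Q = 0, qre ((rep_fun phi ma : quat R) * Q) = 0,
      rep_fun phi lambdaP = qexp beta Q :> quat R &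
      rep_fun phi mp = qexp (eps * f beta) Q :> quat R].
Proof.
have [phiM [[CA CB _ _ CH] [W perturb]]] := rep_funP phi.
have [x xE] : exists x : tangle_group, x = (ma * mp^-1)%g by eexists.
set X : quat R := rep_fun phi x; set H : quat R := rep_fun phi mh.
set A : quat R := rep_fun phi ma; set P : quat R := rep_fun phi mp.
have QE : quat_of_SU2 (rep_fun phi axis) = H * X.
  by rewrite /axis -mulgA -xE phiM SU2M.
(* As [w] goes to the central element [-1], its relation says that the commutator of [X] and [H] is
   [-1]. *)
have XH : X * H = - (H * X).
  have wC (y : SU2 R) : (y * rep_fun phi mw = rep_fun phi mw * y)%g.
    by apply: SU2_inj; rewrite !SU2M W mulrN1 mulN1r.
  have wE : (rep_fun phi x * rep_fun phi mh =
      rep_fun phi mw * (rep_fun phi mh * rep_fun phi x))%g.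
    have /(congr1 (rep_fun phi)) := mwE.
    rewrite -xE !(rep_funM, rep_funV) wC -!mulgA mulVKg mulgV mulg1.
    by move=> /(congr1 (fun y => y * (rep_fun phi mh * rep_fun phi x))%g);
      rewrite -!mulgA mulKg mulVg mulg1.
  by rewrite -SU2M wE !SU2M W mulN1r.
have nH : qnormsq H = 1 by apply: SU2_norm.
have nX : qnormsq X = 1 by apply: SU2_norm.
have [X0 XH0] := anticomm_pure CH nH XH.
have HX0 : qre (H * X) = 0 by rewrite qre_mulC.
have AE : A = X * P by rewrite -SU2M -rep_funM xE mulgVK.
(* By cyclicity, the real part of [A * (H * X)] is that of [- H * P], a combination of the vanishing
   real parts of [H] and [X]. *)
have QA beta : P = qexp (eps * f beta) (H * X) -> qre (A * (H * X)) = 0.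
  move=> PE; have HXX : H * X * X = - H by rewrite -mulrA pure_sqr// mulrN1.
  rewrite AE qre_mulC mulrA PE qre_mul_qexp HXX mulNr mulrA pure_sqr//.
  by rewrite mulN1r opprK X0 qreN CH; ring.
have [b [Q0 CQ0 LE]] := SU2_polar (rep_fun phi lambdaP).
have PE : P = qexp (eps * f b) Q0 by apply: perturb.
rewrite QE; have [sb0|sb0] := eqVneq (sin b) 0.
  (* Now [lambdaP] goes to 1 or -1 and [P = 1], so [H * X] may replace [Q0]. *)
  have PE' : P = qexp (eps * f b) (H * X)
    by rewrite PE (f_sin0 f0 f_odd f_periodic sb0) mulr0 !qexp0.
  exists b; split=> //; first exact: QA PE'.
  by rewrite LE /qexp sb0 !scale0r.
have XQ0 : qre (X * Q0) = 0.
  have : qre A = 0 by exact: CA.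
  rewrite AE PE qre_mul_qexp X0 mulr0 add0r => /eqP.
  by rewrite mulf_eq0 (negbTE (sin_perturbation_neq0 sb0)) => /eqP.
have HQ0 : qre (H * Q0) = 0.
  have : qre (rep_fun phi mb) = 0 by exact: CB.
  have -> : mb = (lambdaP * mh^-1)%g by rewrite /lambdaP mulgK.
  rewrite rep_funM rep_funV SU2M SU2V Ci_qconj// -/H qre_mulC LE.
  rewrite qre_mul_qexp mulNr => /eqP.
  rewrite !qreN CH oppr0 mulr0 add0r mulrN oppr_eq0.
  by rewrite mulf_eq0 (negbTE sb0) => /eqP.
(* Anticommuting with both [X] and [H], [Q0] commutes with their product. *)
have : H * X = Q0 \/ H * X = - quat_of_SU2 Q0.
  apply: pure_comm => //; first by rewrite qnormsqM nH nX mulr1.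
    exact: SU2_norm.
  have Q0X : quat_of_SU2 Q0 * X = - (X * Q0) by apply: pure_anticomm.
  have Q0H : quat_of_SU2 Q0 * H = - (H * Q0) by apply: pure_anticomm.
  by rewrite [RHS]mulrA Q0H mulNr -[in RHS]mulrA Q0X mulrN opprK mulrA.
case=> QQ0.
  by exists b; rewrite QQ0; split=> //; rewrite -QQ0; apply: (QA b); rewrite QQ0.
have Q0E : quat_of_SU2 Q0 = - (H * X) by rewrite QQ0 opprK.
(* Reversing the axis changes [b] to [- b], consistently because [f] is odd. *)
have PE' : P = qexp (eps * f (- b)) (H * X).
  by rewrite PE Q0E qexpN f_odd mulrN.
by exists (- b); split=> //; [exact: QA PE'|rewrite LE Q0E qexpN].
Qed.

Local Notation rho := (rho_rep eps f0 f_odd f_periodic).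

(** The rotation taking [phi ma] to [i] and the axis to [k] carries along the exponentials about
    that axis and fixes [-1], which settles all five elements of [tangle_morph_ext]. *)
Lemma conjugate_to_rho phi : exists beta, conjugate phi (rho beta).
Proof.
have [beta [Q0 AQ LE PE]] := common_axis phi; exists beta.
have [phiM [[CA _ _ _ _] [W _]]] := rep_funP phi.
have [g ng [gA gQ]] := pure_frame CA Q0 (SU2_norm _) (SU2_norm _) AQ.
exists (mkSU2 ng) => x; rewrite rho_repE; apply/esym; move: x.
have rhoM := rho_homM f eps beta.
apply: tangle_morph_ext => //.
- by move=> x y; rewrite phiM !mulgA mulgVK.
- apply: SU2_conj_eq; rewrite rho_hom_gen /= eijE.
  by rewrite [qexp _ _]qexp0 mul1r.
- apply: SU2_conj_eq; rewrite rho_hom_gen /= expkE PE.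
  exact: intertwine_qexp.
- apply: SU2_conj_eq; rewrite rho_hom_gen /= expkpi W.
  by rewrite mulrN1 mulN1r.
- apply: SU2_conj_eq; rewrite rho_hom_lambda expkE LE.
  exact: intertwine_qexp.
- by apply: SU2_conj_eq; rewrite rho_hom_axis expk_val cos_pihalf sin_pihalf.
Qed.

(** * Half traces as separating functions on conjugacy classes *)

Definition half_trace (x : tangle_group) (c : char_variety f eps) : R :=
  qre (rep_fun (repr c) x).

Lemma conj_class_eq phi psi : conj_class phi = conj_class psi <-> conjugate phi psi.
Proof.
split=> [/eqquotP/asboolP//|?].
by apply/eqquotP/asboolP.
Qed.

(** The real part of a unit quaternion is half its trace, hence invariant under conjugation. *)
Lemma half_trace_class x phi : half_trace x (conj_class phi) = qre (rep_fun phi x).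
Proof.
have /conj_class_eq[g E] : conj_class phi = conj_class (repr (conj_class phi)).
  by rewrite [RHS]reprK.
by rewrite /half_trace E SU2M qre_mulC -SU2M mulgA mulVg mul1g.
Qed.

Lemma half_trace_continuous x : continuous (half_trace x).
Proof.
apply: (@repr_comp_continuous _ _ _ (fun phi : rep f eps => qre (rep_fun phi x))).
  have cval : continuous (fun phi : rep f eps => rep_fun phi x).
    move=> phi; apply: (@continuous_comp (rep f eps) {ptws tangle_group -> SU2 R} (SU2 R)
      set_val (fun g => g x)); last first.
    exact: (@ptws_eval_continuous tangle_group (SU2 R) x).
    exact: initial_continuous.
  by have /continuous_SU2/continuous_quat[] := cval.
move=> phi psi /eqP E; apply/eqP.
by rewrite -!half_trace_class; congr half_trace.
Qed.

(** The representation itself is unchanged: the angles at [Gb] and [Gc] gain [n] full turns, and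
    elsewhere [beta] enters only through [f]. *)
Lemma rho_mod2pi beta (n : int) :
  conj_class (rho (beta + n%:~R * (2 * pi))) = conj_class (rho beta).
Proof.
have eijz t : eij (t + n%:~R * (2 * pi)) = eij t :> SU2 R.
  apply: SU2_inj; rewrite !eij_val (periodicz (@cos_periodic R)).
  by rewrite (periodicz (@sin_periodic R)).
congr conj_class; apply: val_inj; congr pres_hom; apply/funext => x.
rewrite /rho_gen (periodicz f_periodic); case: x => //.
  by rewrite -[RHS]eijz; congr eij; ring.
by rewrite -[RHS]eijz; congr eij; ring.
Qed.

Lemma class_rho (c : char_variety f eps) : exists beta, c = conj_class (rho beta).
Proof.
have [beta E] := conjugate_to_rho (repr c); exists beta.
by rewrite -[LHS]reprK; apply/conj_class_eq.
Qed.

(* As [cos (eps * f beta) > 0], these values determine [cos beta] and [sin beta]. *)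
Lemma half_traces_rho beta :
  [/\ half_trace lambdaP (conj_class (rho beta)) = cos beta,
      half_trace (mb * ma)%g (conj_class (rho beta)) = sin (beta + eps * f beta) &
      half_trace (mh * ma)%g (conj_class (rho beta)) = - sin (eps * f beta)].
Proof.
rewrite !half_trace_class !rho_repE rho_hom_lambda.
have -> : rho_hom f eps beta (mb * ma)%g =
    expk (beta + eps * f beta - pi / 2 + pi *+ 2).
  by rewrite rho_homM !rho_hom_gen /= eijM; congr expk; rewrite -mulr_natl; lra.
have -> : rho_hom f eps beta (mh * ma)%g = expk (eps * f beta + pi / 2).
  by rewrite rho_homM !rho_hom_gen /= eijM; congr expk; lra.
by rewrite !expk_val; split=> //=; rewrite ?cosD2pi ?cosBpihalf ?cosDpihalf.
Qed.

Lemma rho_half_traces_inj beta beta' :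
  (forall x, half_trace x (conj_class (rho beta)) =
    half_trace x (conj_class (rho beta'))) ->
  exists n : int, beta' = beta + n%:~R * (2 * pi).
Proof.
move=> E; have [l1 b1 h1] := half_traces_rho beta.
have [l2 b2 h2] := half_traces_rho beta'.
have := E lambdaP; have := E (mb * ma)%g; have := E (mh * ma)%g.
rewrite {}l1 {}l2 {}b1 {}b2 {}h1 {}h2 => /oppr_inj hs hb hl.
apply: cos_sin_mod2pi => //.
(* The sines agree, so the squares of the cosines do; positivity removes the sign. *)
have hc : cos (eps * f beta) = cos (eps * f beta').
  apply/eqP; rewrite -(@eqrXn2 _ 2) ?ltW ?cos_perturbation_gt0//.
  by rewrite !cos2sin2 hs.
(* After expansion the terms with [cos beta] cancel, then the nonzero factor
   [cos (eps * f beta)]. *)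
move: hb; rewrite !sinD hl hs hc => /addIr /mulIf; apply.
by rewrite gt_eqF ?cos_perturbation_gt0.
Qed.

Lemma char_variety_separated (c c' : char_variety f eps) :
  (forall x, half_trace x c = half_trace x c') -> c = c'.
Proof.
have [b ->] := class_rho c; have [b' ->] := class_rho c'.
by move=> /rho_half_traces_inj[n ->]; rewrite rho_mod2pi.
Qed.

Lemma char_variety_hausdorff : hausdorff_space (char_variety f eps).
Proof.
apply: (@hausdorff_of_separating R) => c c' sep; apply: char_variety_separated => x.
by apply: sep; exact: half_trace_continuous.
Qed.

(** * The circle and its homeomorphism with the space of classes *)

Lemma angle_eq (x y : R) :
  angle x = angle y <-> exists n : int, y = x + n%:~R * (2 * pi).
Proof.
split=> [/eqquotP/asboolP//|?].
by apply/eqquotP/asboolP.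
Qed.

(** Removing [floor (x / (2 * pi))] full turns shows that the circle is the continuous image of a
    segment. *)
Lemma circle_compact : compact [set: circle R].
Proof.
have -> : [set: circle R] = @angle R @` `[0, 2 * pi].
  apply/seteqP; split=> // c _.
  have p2 : 0 < 2 * pi :> R by rewrite mulr_gt0 ?pi_gt0.
  pose x : R := repr c; pose n := Num.floor (x / (2 * pi)).
  exists (x - n%:~R * (2 * pi)).
    rewrite /= in_itv /=; apply/andP; split.
      by rewrite subr_ge0 -ler_pdivlMr// Num.Theory.ge_floor.
    rewrite lerBlDr (_ : _ + _ = (n + 1)%:~R * (2 * pi)); last first.
      by rewrite intrD; ring.
    by rewrite -ler_pdivrMr// ltW// floorD1_gt.
  rewrite -[RHS]reprK; apply/angle_eq; exists n.
  by rewrite subrK.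
apply: continuous_compact; last exact: segment_compact.
by apply: continuous_subspaceT; exact: pi_continuous.
Qed.

Definition circle_to_variety (c : circle R) : char_variety f eps :=
  conj_class (rho (repr c)).

Lemma circle_to_varietyE beta :
  circle_to_variety (angle beta) = conj_class (rho beta).
Proof.
have /esym/angle_eq[n E] : angle (repr (angle beta)) = angle beta by exact: reprK.
by rewrite /circle_to_variety E rho_mod2pi.
Qed.

Lemma circle_to_variety_homeomorphism : homeomorphism circle_to_variety.
Proof.
apply: compact_hausdorff_homeomorphism.
- exact: circle_compact.
- exact: char_variety_hausdorff.
- apply/quotient_continuous.
  have -> : circle_to_variety \o \pi_(circle R) = @conj_class _ f eps \o rho.
    by apply/funext => b; exact: circle_to_varietyE.
  move=> b; apply: continuous_comp; first exact: rho_rep_continuous.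
  exact: pi_continuous.
- move=> c c' E; rewrite -[c]reprK -[c']reprK; apply/angle_eq.
  by apply: rho_half_traces_inj => x; rewrite -/(circle_to_variety c) E.
- by move=> y; have [b ->] := class_rho y; exists (angle b); rewrite circle_to_varietyE.
Qed.

End Representations.

Theorem theorem7p1 (R : realType) (f : R -> R)
  (f_smooth : smooth f)
  (f0 : f 0 = 0)
  (f_le1 : forall x : R, `|f x| <= 1)
  (f_odd : forall x : R, f (- x) = - f x)
  (f_periodic : periodic f (2 * pi))
  (f_neq0 : forall x : R, (forall n : int, x <> n%:~R * pi) -> f x <> 0) :
  exists2 eps0 : R, 0 < eps0 &
    forall eps : R, 0 < eps < eps0 ->
      exists rho : R -> rep f eps,
        (forall beta : R, is_rho beta (rho beta)) /\
        exists F : circle R -> char_variety f eps,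
          homeomorphism F /\
          (forall beta : R, F (angle beta) = conj_class (rho beta)).
Proof.
(* With threshold 1, [eps * f] stays in [(-1, 1)], where cosine is positive and sine vanishes only
   at 0. *)
exists 1 => // eps eps_lt1; exists (rho_rep eps f0 f_odd f_periodic).
split=> [beta|]; first exact: is_rho_rep.
exists (circle_to_variety eps f0 f_odd f_periodic).
split=> [|beta]; last exact: circle_to_varietyE.
apply: circle_to_variety_homeomorphism => // x.
by apply/differentiable_continuous/derivable1_diffP; exact: (f_smooth 0%N x).
Qed.
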